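(* If $G$ and $H$ are two disjoint complete graphs, then $\mathcal{V}(G\vee H)=\mathcal{V}(G)\cdot\mathcal{V}(H)$.
   Context: Graphs are finite, simple and undirected. For a graph $G=(V,E)$ and $X\subseteq V$, two vertices $u,v$ are $X$-visible if there is a shortest $(u,v)$-path $P$ in $G$ with $V(P)\cap X\subseteq\{u,v\}$. A set $X\subseteq V$ is a mutual-visibility set of $G$ if every pair of vertices in $X$ is $X$-visible (the empty set counts as a mutual-visibility set). The visibility polynomial of $G$ is $\mathcal{V}(G)=\sum_{i\ge 0} r_i x^i$, where $r_i$ is the number of mutual-visibility sets of $G$ of cardinality $i$. For vertex-disjoint graphs $G$ and $H$, the join $G\vee H$ is the graph with vertex set $V(G)\cup V(H)$ and edge set $E(G)\cup E(H)\cup\{uv: u\in V(G), v\in V(H)\}$. *)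

(* Defs.v *)
From mathcomp Require Import all_boot all_order all_algebra.
From mathcomp Require Import boolp.

Set Implicit Arguments.
Unset Strict Implicit.
Unset Printing Implicit Defensive.

Import GRing.Theory.

Record sgraph := SGraph {
  vertex :> finType;
  adj : rel vertex;
  adj_sym : symmetric adj;
  adj_irrefl : irreflexive adj
}.

Definition complete (G : sgraph) : Prop :=
  forall u v : G, u != v -> adj u v.

Section Visibility.
Variable G : sgraph.

(* As in path.v, the path has vertex sequence u :: p and length size p. *)
Definition is_path (u v : G) (p : seq G) : Prop :=
  [/\ path (@adj G) u p, last u p = v & uniq (u :: p)].

Definition shortest_path (u v : G) (p : seq G) : Prop :=
  is_path u v p /\ forall q : seq G, is_path u v q -> size p <= size q.

Definition visible (X : {set G}) (u v : G) : Prop :=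
  exists2 p : seq G, shortest_path u v p &
    [set w in u :: p] :&: X \subset [set u; v].

(* The case u = v is harmless: the one-vertex path always witnesses it. *)
Definition mutual_visibility (X : {set G}) : Prop :=
  forall u v : G, u \in X -> v \in X -> visible X u v.

Definition num_mutual_visibility (i : nat) : nat :=
  #|[set X : {set G} | `[< mutual_visibility X >] & #|X| == i]|.

(* No set has more than #|G| vertices, so the sum over all i stops there. *)
Definition visibility_poly : {poly int} :=
  (\sum_(i < #|G|.+1) (num_mutual_visibility i)%:R *: 'X^i)%R.

End Visibility.

(* The sum type makes the two vertex sets disjoint. *)
Section Join.
Variables G H : sgraph.

Definition join_adj : rel (G + H)%type := fun a b =>
  match a, b with
  | inl u, inl v => adj u v
  | inr u, inr v => adj u v
  | _, _ => true
  end.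

Fact join_adj_sym : symmetric join_adj.
Proof. by move=> [u|u] [v|v] //=; rewrite adj_sym. Qed.

Fact join_adj_irrefl : irreflexive join_adj.
Proof. by move=> [u|u] /=; rewrite adj_irrefl. Qed.

Definition join : sgraph := SGraph join_adj_sym join_adj_irrefl.

End Join.

(* Main.v *)
Require Import Defs.
From mathcomp Require Import all_boot all_order all_algebra.
From mathcomp Require Import boolp.

(** In a complete graph two distinct vertices are joined by an edge, and that
    edge is a shortest path without inner vertices; hence no set of vertices
    can block it and every set is a mutual-visibility set
    ([complete_mutual_visibility]). Counting subsets by cardinality, the
    binomial theorem turns the visibility polynomial of the complete graph on
    [n] vertices into [(1 + 'X) ^+ n] ([visibility_poly_complete]). Since the
    join of two complete graphs is the complete graph on the union of their
    vertices, the product formula is the law of exponents. *)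

Set Implicit Arguments.
Unset Strict Implicit.
Unset Printing Implicit Defensive.

Import GRing.Theory.

Lemma complete_mutual_visibility (G : sgraph) (X : {set G}) :
  complete G -> mutual_visibility X.
Proof.
move=> hG u v _ _; have [<-|neq_uv] := eqVneq u v.
  exists [::]; first by split=> //; split.
  by apply/subsetP=> w; rewrite !inE => /andP[-> _].
exists [:: v]; last by apply/subsetP=> w; rewrite !inE => /andP[].
split; first by split; rewrite //= ?hG // inE neq_uv.
by case=> [|w q] // [_ /= eq_uv]; rewrite eq_uv eqxx in neq_uv.
Qed.

Lemma num_mutual_visibility_complete (G : sgraph) (i : nat) :
  complete G -> num_mutual_visibility G i = 'C(#|G|, i).
Proof.
move=> hG; rewrite -card_draws; apply: eq_card => X; rewrite !inE.
by rewrite (asboolT (complete_mutual_visibility hG)).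
Qed.

Lemma visibility_poly_complete (G : sgraph) :
  complete G -> visibility_poly G = ((1 + 'X) ^+ #|G|)%R.
Proof.
move=> hG; rewrite /visibility_poly exprDn; apply: eq_bigr => i _.
by rewrite num_mutual_visibility_complete // expr1n mul1r scaler_nat.
Qed.

Lemma join_complete (G H : sgraph) :
  complete G -> complete H -> complete (join G H).
Proof. by move=> hG hH [u|u] [v|v] //= neq_uv; [apply: hG|apply: hH]. Qed.

Theorem theorem16 (G H : sgraph) (hG : complete G) (hH : complete H) :
  visibility_poly (join G H) = (visibility_poly G * visibility_poly H)%R.
Proof.
rewrite !visibility_poly_complete //; last exact: join_complete.
by rewrite card_sum exprD.
Qed.
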